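(* For every integer $k\ge 2$, there are only finitely many connected graphs $G$ (up to isomorphism) such that $\mathrm{rank}_d(G)=k$.
   Context: All graphs are finite, simple (no loops, no multiple edges). For a connected graph $G$ with vertices $v_1,\dots,v_n$, the distance matrix $D(G)$ is the $n\times n$ matrix whose $(i,j)$-entry is $d_G(v_i,v_j)$, the number of edges of a shortest path between $v_i$ and $v_j$. The distance rank $\mathrm{rank}_d(G)$ is the rank of $D(G)$. *)

(* Defs.v *)
From mathcomp Require Import all_boot all_order all_algebra.

Set Implicit Arguments.
Unset Strict Implicit.
Unset Printing Implicit Defensive.

Import GRing.Theory.

Record sgraph := SGraph {
  vertex :> finType;
  adj : rel vertex;
  adj_sym : symmetric adj;
  adj_irrefl : irreflexive adj }.

Definition sgraph_iso (G H : sgraph) : Prop :=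
  exists2 f : G -> H, bijective f & forall x y, adj (f x) (f y) = adj x y.

(* The graph without vertices is not regarded as connected. *)
Definition connected (G : sgraph) : Prop :=
  0 < #|G| /\ forall x y : G, connect (@adj G) x y.

(* Some path from x to y (without repeated vertices) has exactly n edges. *)
Definition has_path (G : sgraph) (x y : G) (n : nat) : bool :=
  [exists p : n.-tuple G,
     [&& path (@adj G) x p, uniq (x :: p) & last x p == y]].

(* The least n such that has_path x y n.  A path has fewer than #|G| edges, so
   the search below is exhaustive; the junk value #|G| is taken exactly when x
   and y lie in different components. *)
Definition dist (G : sgraph) (x y : G) : nat :=
  find (has_path x y) (iota 0 #|G|).

Lemma has_path_dist (G : sgraph) (x y : G) :
  connect (@adj G) x y -> has_path x y (dist x y).
Proof.
case/connectP=> p0 p0P ->; case/shortenP: p0P => p pP Up _.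
have lt_p : size p < #|G|.
  by rewrite -[_ < _]/(size (x :: p) <= _) -(card_uniqP Up) max_card.
have hasp : has (has_path x (last x p)) (iota 0 #|G|).
  apply/hasP; exists (size p); first by rewrite mem_iota.
  by apply/existsP; exists (in_tuple p); rewrite pP Up eqxx.
have := nth_find 0 hasp; rewrite nth_iota //.
by move: hasp; rewrite has_find size_iota.
Qed.

Lemma dist_min (G : sgraph) (x y : G) (n : nat) :
  has_path x y n -> dist x y <= n.
Proof.
move=> xyn; rewrite leqNgt; apply/negP => lt_n.
have := before_find 0 lt_n; rewrite nth_iota ?xyn //.
apply: leq_trans lt_n _.
by rewrite -[X in _ <= X](size_iota 0); apply: find_size.
Qed.

Local Open Scope ring_scope.

(* The entries are integers, so the rank over rat is the rank over the reals. *)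
Definition distance_matrix (G : sgraph) : 'M[rat]_#|G| :=
  \matrix_(i, j) (dist (enum_val i) (enum_val j))%:R.

Definition distance_rank (G : sgraph) : nat := \rank (distance_matrix G).

(* Main.v *)
Require Import Defs.
From mathcomp Require Import all_boot all_order all_algebra.
From mathcomp Require Import zify.

(** Let [v_0, ..., v_d] be a shortest path.  The distance matrix restricted to
    these vertices is [|i - j|]; the second differences of its inner rows form twice
    the identity matrix; hence [d - 1 <= rank], so the rank bounds the diameter.
    Choose [k = rank] rows spanning the row space: two columns that agree on
    these rows agree everywhere, so their vertices coincide because a distance
    vanishes only on the diagonal.  Hence a vertex is determined by [k]
    distances, each at most [k + 1], and the graph has at most [(k + 2) ^ k]
    vertices. *)

Section Distance.

Context {G : sgraph}.
Implicit Types (x y z : G) (p : seq G).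

(** The walk [p] may repeat vertices; shortening it gives a path whose vertices all lie in [p],
    hence no longer. *)
Lemma dist_path x p : path (@adj G) x p -> dist x (last x p) <= size p.
Proof.
case/shortenP=> q qP Uq sub_q.
apply: leq_trans (uniq_leq_size (proj2 (andP Uq)) sub_q).
by apply: dist_min; apply/existsP; exists (in_tuple q); rewrite qP Uq eqxx.
Qed.

Lemma shortest_path x y : connect (@adj G) x y ->
  exists p, [/\ path (@adj G) x p, last x p = y & size p = dist x y].
Proof.
by case/has_path_dist/existsP=> p /and3P[pP _ /eqP py]; exists p; rewrite size_tuple.
Qed.

Lemma distxx x : dist x x = 0.
Proof. by apply/eqP; rewrite -leqn0; apply: (@dist_path x [::]). Qed.

Hypothesis G_connected : forall x y, connect (@adj G) x y.

Lemma dist_eq0 x y : dist x y = 0 -> x = y.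
Proof.
by have [p [_ <- <-]] := shortest_path _ _ (G_connected x y); case: p.
Qed.

Lemma dist_sym x y : dist x y = dist y x.
Proof.
have le_dist (u w : G) : dist u w <= dist w u.
  have [p [pP <- <-]] := shortest_path _ _ (G_connected w u).
  have := @dist_path (last w p) (rev (belast w p)).
  rewrite rev_path (eq_path (e' := @adj G)) => [/(_ pP)|a b]; last exact: adj_sym.
  rewrite size_rev size_belast; congr (dist _ _ <= _).
  by case: p {pP} => //= a p; rewrite rev_cons last_rcons.
by apply/eqP; rewrite eqn_leq !le_dist.
Qed.

Lemma dist_triangle y x z : dist x z <= dist x y + dist y z.
Proof.
have [p [pP py <-]] := shortest_path _ _ (G_connected x y).
have [q [qP qz <-]] := shortest_path _ _ (G_connected y z).
by rewrite -size_cat -qz -py -last_cat dist_path // cat_path pP py.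
Qed.

(** With truncated subtraction, [(i - j) + (j - i)] is the absolute difference of [i] and [j]. *)
Lemma geodesic x y : exists v : nat -> G, forall i j,
  i <= dist x y -> j <= dist x y -> dist (v i) (v j) = (i - j) + (j - i).
Proof.
have [p [pP py sz_p]] := shortest_path _ _ (G_connected x y).
pose v i := nth x (x :: p) i; exists v.
have v_last i : i <= size p -> v i = last x (take i p).
  move=> le_ip; rewrite (last_nth x) size_takel // /v.
  by case: i le_ip => //= i *; rewrite nth_take.
have upper i j : i <= j -> j <= size p -> dist (v i) (v j) <= j - i.
  move=> le_ij le_jp; have le_ip := leq_trans le_ij le_jp.
  have v_sub : last (v i) (take (j - i) (drop i p)) = v j.
    by rewrite v_last // -last_cat -takeD subnKC // -v_last.
  have := pP; rewrite -(cat_take_drop j p) cat_path => /andP[+ _].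
  rewrite -{1}(subnKC le_ij) takeD cat_path -v_last // => /andP[_ /dist_path].
  by rewrite v_sub => /leq_trans; apply; rewrite size_take_min geq_minl.
have v0 : v 0 = x by [].
have vd : v (size p) = y by rewrite v_last // take_size.
have exact_dist i j : i <= j -> j <= size p -> dist (v i) (v j) = j - i.
  move=> le_ij le_jp; have le_ip := leq_trans le_ij le_jp.
  have := upper _ _ le_ij le_jp.
  have := upper 0 i isT le_ip; have := upper j _ le_jp (leqnn _).
  have := dist_triangle (v i) x y; have := dist_triangle (v j) (v i) y.
  rewrite v0 vd -sz_p; lia.
rewrite -sz_p => i j le_i le_j; have [le_ij|/ltnW le_ji] := leqP i j.
  by rewrite exact_dist //; lia.
by rewrite dist_sym exact_dist //; lia.
Qed.

Lemma dist_le_rank x y : dist x y <= (distance_rank G).+1.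
Proof.
have [v vP] := geodesic x y.
set D := distance_matrix G; set m := (dist x y).-1.
(* [g 1] lists the [m] inner vertices; [g 0] and [g 2] are its shifts by one. Multiplying by [E c]
   on the right keeps the columns [g c]. *)
pose g c (a : 'I_m) := enum_rank (v (c + a)).
pose E c : 'M[rat]_(_, m) := colsub (g c) 1%:M.
have DE : (rowsub (g 1) 1%:M *m D *m (E 0%N + E 2%N - 2%:R *: E 1%N) = 2%:R%:M)%R.
  rewrite mul_rowsub_mx mul1mx mulmxBr mulmxDr -scalemxAr !mulmx_colsub !mulmx1.
  apply/matrixP => a b; rewrite !mxE !enum_rankK.
  have [lt_a lt_b] : a.+1 < dist x y /\ b.+1 < dist x y.
    by have := ltn_ord a; have := ltn_ord b; rewrite /m; lia.
  rewrite !vP; try lia.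
  (* Moving the subtracted term across turns the entry into an equation between natural numbers. *)
  apply/eqP; rewrite GRing.subr_eq -GRing.mulrnA -GRing.natrM -!GRing.natrD.
  by rewrite Num.Theory.eqr_nat -val_eqE /=; lia.
have : \rank (2%:R%:M : 'M[rat]_m)%R <= \rank D.
  by rewrite -DE (leq_trans (mxrankM_maxl _ _)) // mxrankM_maxr.
rewrite mxrank_unit => [|]; first by rewrite /m /distance_rank -/D; lia.
by rewrite unitmxE det_scalar GRing.unitrX.
Qed.

Lemma card_le_rank : #|G| <= (distance_rank G).+2 ^ distance_rank G.
Proof.
rewrite /distance_rank; set D := distance_matrix G.
set f := maxrankfun D; set k := \rank D.
(* [h x] is the column of [x] on the spanning rows; [dist_le_rank] ensures that [inord] loses
   nothing. *)
pose h x : {ffun 'I_k -> 'I_k.+2} := [ffun a => inord (dist (enum_val (f a)) x)].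
have h_inj : injective h.
  move=> x y hxy; apply: dist_eq0.
  have /submxP[W DW] : (D <= rowsub f D)%MS by rewrite eq_maxrowsub.
  (* Row [x] detects equality: its entry in column [x] is 0. By [DW] this row combines the chosen
     rows, on which both columns agree. *)
  suff : D (enum_rank x) (enum_rank x) = D (enum_rank x) (enum_rank y).
    by rewrite !mxE !enum_rankK distxx => /eqP; rewrite Num.Theory.eqr_nat => /eqP.
  rewrite DW !mxE; apply: eq_bigr => a _; rewrite !mxE !enum_rankK.
  have /ffunP/(_ a)/(congr1 val) := hxy; rewrite !ffunE /= !inordK ?ltnS ?dist_le_rank //.
  by move=> ->.
by have := leq_card h h_inj; rewrite card_ffun !card_ord.
Qed.

End Distance.

Section GraphOfRelation.

Variables (n : nat) (e : {ffun 'I_n * 'I_n -> bool}).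

(** Symmetrising and deleting loops makes every boolean function a code of a graph, so the codes of
    a given order form a finite type. *)
Definition rel_adj : rel 'I_n := [rel i j | (i != j) && (e (i, j) || e (j, i))].

Lemma rel_adj_sym : symmetric rel_adj.
Proof. by move=> i j; rewrite /rel_adj /= [i == j]eq_sym orbC. Qed.

Lemma rel_adj_irrefl : irreflexive rel_adj.
Proof. by move=> i; rewrite /rel_adj /= eqxx. Qed.

Definition rel_graph : sgraph := SGraph rel_adj_sym rel_adj_irrefl.

End GraphOfRelation.

Lemma sgraph_iso_rel_graph (G : sgraph) :
  exists e : {ffun 'I_#|G| * 'I_#|G| -> bool}, sgraph_iso G (rel_graph _ e).
Proof.
exists [ffun ij => adj (enum_val ij.1) (enum_val ij.2)].
exists (@enum_rank G) => [|x y]; first exact: enum_rank_bij.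
rewrite /= /rel_adj /= !ffunE /= !enum_rankK (adj_sym y) orbb (inj_eq enum_rank_inj).
by case: eqVneq => // <-; rewrite adj_irrefl.
Qed.

Theorem theorem1 (k : nat) (hk : 2 <= k) :
  exists (N : nat) (F : 'I_N -> sgraph),
    forall G : sgraph, connected G -> distance_rank G = k ->
      exists i : 'I_N, sgraph_iso G (F i).
Proof.
(* Codes of all graphs of order at most [k.+2 ^ k]. *)
pose T := {n : 'I_(k.+2 ^ k).+1 & {ffun 'I_n * 'I_n -> bool}}.
exists #|{: T}|, (fun i => rel_graph _ (tagged (enum_val i))) => G [_ G_conn] rk.
have lt_G : #|G| < (k.+2 ^ k).+1 by rewrite ltnS -rk card_le_rank.
have [e Ge] := sgraph_iso_rel_graph G.
pose t : T := Tagged (fun n : 'I_(k.+2 ^ k).+1 => {ffun 'I_n * 'I_n -> bool})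
                (e : {ffun 'I_(Ordinal lt_G) * 'I_(Ordinal lt_G) -> bool}).
by exists (enum_rank t); rewrite enum_rankK.
Qed.
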